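(* Let $M$ be a finite-dimensional free $\mathbb{T}$-module. Then all bases of $M$ have the same number of elements.
   Context: Bicomplex numbers: $\mathbb{T}$ is the commutative ring of elements $w=z_1+z_2\mathbf{i_2}$ with $z_1,z_2\in\mathbb{C}(\mathbf{i_1})=\{x+y\mathbf{i_1}: x,y\in\mathbb{R}\}$ (a copy of the complex field), where $\mathbf{i_1}^2=\mathbf{i_2}^2=-1$ and $\mathbf{i_1}\mathbf{i_2}=\mathbf{i_2}\mathbf{i_1}=\mathbf{j}$, so $\mathbf{j}^2=1$. A basis of a $\mathbb{T}$-module is a set of $\mathbb{T}$-linearly independent elements that generate the module. A finite-dimensional free $\mathbb{T}$-module is a $\mathbb{T}$-module with a finite basis. *)

(* Defs.v *)
From HB Require Import structures.
From mathcomp Require Import all_boot all_order all_algebra.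
From mathcomp Require Import classical_sets cardinality reals ring.
From mathcomp.real_closed Require Import complex.

Set Implicit Arguments.
Unset Strict Implicit.
Unset Printing Implicit Defensive.

Import GRing.Theory.
Local Open Scope ring_scope.

(* [Bicomplex z1 z2] stands for z1 + z2 i2, where z1 and z2 lie in the copy
   [R[i]] of the complex field whose imaginary unit is i1. *)
Record bicomplex (R : realType) : Type :=
  Bicomplex { bc1 : R[i]; bc2 : R[i] }.

Section BicomplexRing.
Variable R : realType.
Local Notation T := (bicomplex R).

Definition bc_to_pair (w : T) : R[i] * R[i] := (bc1 w, bc2 w).
Definition bc_of_pair (p : R[i] * R[i]) : T := Bicomplex p.1 p.2.

Lemma bc_to_pairK : cancel bc_to_pair bc_of_pair.
Proof. by case. Qed.

HB.instance Definition _ := Equality.copy T (can_type bc_to_pairK).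
HB.instance Definition _ := Choice.copy T (can_type bc_to_pairK).

Definition bc_zero : T := Bicomplex 0 0.
Definition bc_add (v w : T) : T := Bicomplex (bc1 v + bc1 w) (bc2 v + bc2 w).
Definition bc_opp (w : T) : T := Bicomplex (- bc1 w) (- bc2 w).
Definition bc_one : T := Bicomplex 1 0.
(* (z1 + z2 i2) (w1 + w2 i2) expanded with i2 ^ 2 = -1 *)
Definition bc_mul (v w : T) : T :=
  Bicomplex (bc1 v * bc1 w - bc2 v * bc2 w) (bc1 v * bc2 w + bc2 v * bc1 w).

Lemma bc_addA : associative bc_add.
Proof. by move=> u v w; rewrite /bc_add /= !addrA. Qed.

Lemma bc_addC : commutative bc_add.
Proof.
by move=> v w; rewrite /bc_add addrC [bc2 v + _]addrC.
Qed.

Lemma bc_add0 : left_id bc_zero bc_add.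
Proof. by case=> a b; rewrite /bc_add /= !add0r. Qed.

Lemma bc_addN : left_inverse bc_zero bc_opp bc_add.
Proof. by case=> a b; rewrite /bc_add /= !addNr. Qed.

HB.instance Definition _ :=
  GRing.isZmodule.Build T bc_addA bc_addC bc_add0 bc_addN.

Lemma bc_mulA : associative bc_mul.
Proof.
by move=> [a b] [c d] [e f]; rewrite /bc_mul /=; congr Bicomplex; ring.
Qed.

Lemma bc_mulC : commutative bc_mul.
Proof.
by move=> [a b] [c d]; rewrite /bc_mul /=; congr Bicomplex; ring.
Qed.

Lemma bc_mul1 : left_id bc_one bc_mul.
Proof. by case=> a b; rewrite /bc_mul /= !mul1r !mul0r subr0 addr0. Qed.

Lemma bc_mulD : left_distributive bc_mul bc_add.
Proof.
move=> [a b] [c d] [e f]; rewrite /bc_mul /bc_add /= !mulrDl opprD.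
by rewrite addrACA [X in Bicomplex _ X]addrACA.
Qed.

Lemma bc_one_neq0 : bc_one != bc_zero.
Proof. by apply/eqP => -[/eqP]; rewrite oner_eq0. Qed.

HB.instance Definition _ :=
  GRing.Zmodule_isComNzRing.Build T
    bc_mulA bc_mulC bc_mul1 bc_mulD bc_one_neq0.

Definition bc_i1 : T := Bicomplex 'i%C 0.
Definition bc_i2 : T := Bicomplex 0 1.
Definition bc_j : T := bc_i1 * bc_i2.

Lemma bc_i1_sqr : bc_i1 ^+ 2 = -1.
Proof.
rewrite expr2; congr Bicomplex => /=; last by rewrite mulr0 mul0r addr0 oppr0.
by rewrite mulr0 subr0 -expr2 sqr_i.
Qed.

Lemma bc_i2_sqr : bc_i2 ^+ 2 = -1.
Proof.
by rewrite expr2; congr Bicomplex; rewrite /= ?mulr0 ?mul0r ?mulr1 ?addr0 ?sub0r ?oppr0.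
Qed.

Lemma bc_j_sqr : bc_j ^+ 2 = 1.
Proof. by rewrite exprMn bc_i1_sqr bc_i2_sqr mulrNN mulr1. Qed.

(* The inclusion of C(i1) in the bicomplex numbers *)
Definition bc_inj (z : R[i]) : T := Bicomplex z 0.

Lemma bicomplexE (w : T) : w = bc_inj (bc1 w) + bc_inj (bc2 w) * bc_i2.
Proof.
case: w => a b; congr Bicomplex => /=.
  by rewrite !mulr0 mul0r subr0 addr0.
by rewrite mulr1 mul0r addr0 add0r.
Qed.

End BicomplexRing.

Section Bases.
Variables (A : pzRingType) (M : lmodType A).
Implicit Type B : set M.

(* A possibly infinite set: only finite sums of distinct elements matter. *)
Definition lin_indep B : Prop :=
  forall (s : seq M) (c : M -> A),
    uniq s -> (forall x, x \in s -> B x) ->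
    \sum_(x <- s) c x *: x = 0 -> forall x, x \in s -> c x = 0.

Definition generates B : Prop :=
  forall y : M, exists (s : seq M) (c : M -> A),
    (forall x, x \in s -> B x) /\ y = \sum_(x <- s) c x *: x.

Definition is_basis B : Prop := lin_indep B /\ generates B.

Definition finite_dim_free : Prop :=
  exists2 B : set M, finite_set B & is_basis B.

End Bases.

Arguments finite_dim_free {A} M.

(* Main.v *)
(** The map z1 + z2 i2 |-> z1 - i1 z2 is a ring morphism from the bicomplex
    numbers to the complex field.  A basis B of M is finite as soon as M has a
    finite generating set, because that set only involves finitely many elements
    of B.  Writing a finite basis in terms of a generating family and back gives
    matrices with P Q = 1; applying the morphism entrywise transports this
    identity to a field, where the rank bounds the size of the basis by that of
    the generating family. *)
Require Import Defs.
From HB Require Import structures.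
From mathcomp Require Import all_boot all_order all_algebra.
From mathcomp Require Import finmap.
From mathcomp Require Import boolp classical_sets cardinality reals ring.
From mathcomp.real_closed Require Import complex.

Set Implicit Arguments.
Unset Strict Implicit.
Unset Printing Implicit Defensive.

Import GRing.Theory.
Local Open Scope ring_scope.
Local Open Scope classical_set_scope.

Section BicomplexProjection.
Variable R : realType.

(** Evaluation at i2 = -i1, a root of X^2 + 1; equivalently, the coordinate of [w] along the
    idempotent (1 + j)/2. *)
Definition bc_proj (w : bicomplex R) : R[i] := bc1 w - 'i%C * bc2 w.

Lemma bc_proj_is_zmod_morphism : zmod_morphism bc_proj.
Proof. by move=> [a b] [c d]; rewrite /bc_proj /=; ring. Qed.

Lemma bc_proj_is_monoid_morphism : monoid_morphism bc_proj.
Proof.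
split=> [|[a b] [c d]]; rewrite /bc_proj /=; first by rewrite mulr0 subr0.
have i2 : 'i%C * 'i%C = -1 :> R[i] by rewrite -expr2 sqr_i.
(* [ring] does not know the square of ['i], so the factor -1 is isolated and then replaced by
   ['i * 'i]. *)
transitivity (a * c + (-1) * (b * d) - 'i%C * (a * d + b * c)); first by ring.
by rewrite -i2; ring.
Qed.

HB.instance Definition _ :=
  GRing.isZmodMorphism.Build (bicomplex R) R[i] bc_proj bc_proj_is_zmod_morphism.
HB.instance Definition _ :=
  GRing.isMonoidMorphism.Build (bicomplex R) R[i] bc_proj
    bc_proj_is_monoid_morphism.

End BicomplexProjection.

Section FiniteBases.
Variables (A : nzRingType) (M : lmodType A).
Implicit Types (B : set M) (s t : seq M).

(** Coefficients of repeated entries of [s] add up, and entries of [t] outside [s] get 0. This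
    normalizes the sums in [generates], whose lists may have repetitions. *)
Lemma lincomb_subset s t (c : M -> A) : uniq t -> {subset s <= t} ->
  exists d : M -> A, \sum_(x <- s) c x *: x = \sum_(x <- t) d x *: x.
Proof.
move=> ut; elim: s => [|y s IHs] st.
  by exists (fun=> 0); rewrite big_nil big1 // => x _; rewrite scale0r.
have [|d dE] := IHs; first by move=> x xs; apply: st; rewrite inE xs orbT.
have yt : y \in t by apply: st; rewrite inE eqxx.
exists (fun x => (if x == y then c y else 0) + d x).
rewrite big_cons dE; under [RHS]eq_bigr do rewrite scalerDl.
rewrite big_split /=; congr (_ + _).
rewrite (bigD1_seq y) //= eqxx big1 ?addr0 // => x /negPf ->.
by rewrite scale0r.
Qed.

Lemma generates_seq t : uniq t -> generates [set` t] ->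
  exists Q : M -> M -> A, forall y, y = \sum_(x <- t) Q y x *: x.
Proof.
move=> ut gt; suff /choice[Q QE] : forall y, exists c : M -> A,
    y = \sum_(x <- t) c x *: x by exists Q.
by move=> y; have [s [c [st ->]]] := gt y; apply: lincomb_subset.
Qed.

Lemma lincomb_lincomb s t (a : M -> A) (c : M -> M -> A) :
  \sum_(y <- t) a y *: (\sum_(z <- s) c y z *: z)
  = \sum_(z <- s) (\sum_(y <- t) a y * c y z) *: z.
Proof.
under eq_bigr do rewrite scaler_sumr; rewrite exchange_big /=.
by apply: eq_bigr => z _; rewrite scaler_suml; apply: eq_bigr => y _; rewrite scalerA.
Qed.

(** An element [x] of [B] outside [s] would be a combination of [s], hence satisfy a relation on
    [x :: s] with coefficient -1 at [x]. *)
Lemma lin_indep_generates_eq B s : lin_indep B -> uniq s ->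
  [set` s] `<=` B -> generates [set` s] -> B = [set` s].
Proof.
move=> iB us sB gs; apply/seteqP; split => // x Bx /=.
case: (boolP (x \in s)) => // xs.
have [Q QE] := generates_seq us gs.
have := iB (x :: s) (fun z => if z == x then -1 else Q x z).
rewrite /= xs us big_cons eqxx scaleN1r => /(_ isT) H.
have {H} /(_ x) : forall z, z \in x :: s -> (if z == x then -1 else Q x z) = 0.
  apply: H => [z|]; first by rewrite inE => /orP[/eqP ->//|]; exact: sB.
  apply/eqP; rewrite addrC subr_eq0; apply/eqP; rewrite [RHS]QE big_seq [RHS]big_seq.
  apply: eq_bigr => z zs; case: eqP => // zx; by rewrite -zx zs in xs.
rewrite inE eqxx => /(_ isT) /eqP; by rewrite oppr_eq0 oner_eq0.
Qed.

Lemma basis_seq B t : uniq t -> generates [set` t] -> is_basis B ->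
  exists2 s, uniq s & B = [set` s].
Proof.
move=> ut gt [iB gB]; have [Q QE] := generates_seq ut gt.
have [S SE] := choice gB.
(* The elements of [B] used to expand the entries of [t]: they generate every entry of [t], hence
   all of [M]. *)
pose s := undup (flatten (map S t)); have us : uniq s by apply: undup_uniq.
have sB : [set` s] `<=` B.
  move=> x /=; rewrite mem_undup => /flatten_mapP[y _].
  by have [c [SB _]] := SE y; apply: SB.
exists s => //; apply: lin_indep_generates_eq => // x.
have [d dE] : exists d : M -> M -> A, forall y, y \in t ->
    y = \sum_(z <- s) d y z *: z.
  suff /choice[d dE] : forall y, exists c : M -> A,
    y \in t -> y = \sum_(z <- s) c z *: z by exists d.
  move=> y; have [yt|_] := boolP (y \in t); last by exists (fun=> 0).
  have [c [_ yE]] := SE y.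
  have [|e eE] := @lincomb_subset (S y) s c us; last by exists e; rewrite -eE.
  by move=> z zS; rewrite mem_undup; apply/flatten_mapP; exists y.
exists s, (fun z => \sum_(y <- t) Q x y * d y z); split=> //.
rewrite -lincomb_lincomb [LHS]QE big_seq [RHS]big_seq.
by apply: eq_bigr => y yt; rewrite -dE.
Qed.

Lemma leq_size_basis_generates (F : fieldType) (f : {rmorphism A -> F}) s t :
  uniq s -> uniq t -> is_basis [set` s] -> generates [set` t] ->
  (size s <= size t)%N.
Proof.
move=> us ut [is_s gs] gt.
have [Q QE] := generates_seq us gs; have [P PE] := generates_seq ut gt.
have PQ x z : x \in s -> z \in s ->
    \sum_(y <- t) P x y * Q y z = (x == z)%:R.
  move=> xs zs; apply/eqP; rewrite -subr_eq0; apply/eqP.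
  (* Expanding [x] along [t], then each entry of [t] along [s], gives back [x]; these coefficients
     thus express x - x = 0 on [s]. *)
  apply: (is_s s (fun z => \sum_(y <- t) P x y * Q y z - (x == z)%:R)) => //.
  under eq_bigr do rewrite scalerBl.
  rewrite sumrB -lincomb_lincomb.
  under eq_bigr do rewrite -QE.
  rewrite -PE (bigD1_seq x) //= eqxx scale1r big1 ?addr0 ?subrr // => w.
  by rewrite eq_sym => /negPf ->; rewrite scale0r.
pose u := tnth (in_tuple s); pose v := tnth (in_tuple t).
pose MP := \matrix_(i, j) f (P (u i) (v j)).
pose MQ := \matrix_(j, k) f (Q (v j) (u k)).
have MPQ : MP *m MQ = 1%:M.
  apply/matrixP => i k; rewrite !mxE.
  under eq_bigr do rewrite !mxE -rmorphM.
  rewrite -rmorph_sum -(big_tuple _ _ (in_tuple t) predT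
    (fun y => P (u i) y * Q y (u k))) /= PQ ?mem_tnth //.
  (* The entries of [s] are distinct, so equality of entries is equality of indices and the product
     is the identity matrix. *)
  by rewrite rmorph_nat /u (inj_eq (tuple_uniqP (in_tuple s) us)).
rewrite -(mxrank1 F (size s)) -MPQ.
exact: leq_trans (mxrankM_maxl _ _) (rank_leq_col _).
Qed.

Lemma card_eq_basis (F : fieldType) (f : {rmorphism A -> F}) (B1 B2 : set M) :
  finite_dim_free M -> is_basis B1 -> is_basis B2 -> (B1 #= B2)%card.
Proof.
move=> [B /finite_seqP[t0 ->] [_ gt]] hB1 hB2.
have {}gt : generates [set` undup t0].
  by congr generates: gt; apply/seteqP; split=> x /=; rewrite mem_undup.
have ut := undup_uniq t0.
have [s1 us1 E1] := basis_seq ut gt hB1; have [s2 us2 E2] := basis_seq ut gt hB2.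
rewrite {}E1 {}E2 in hB1 hB2 *.
have sz : size s1 = size s2.
  (* Each basis also generates, so the size bound applies in both directions. *)
  apply/eqP; rewrite eqn_leq; case: (hB1) (hB2) => [_ g1] [_ g2].
  by rewrite !(leq_size_basis_generates f).
have cI s : uniq s -> ([set` s] #= `I_(size s))%card.
  move=> us; have -> : [set` s] = [set` [fset x in s]%fset].
    by apply/seteqP; split=> x /=; rewrite inE.
  by apply/card_eq_fsetP; rewrite card_fseq undup_id.
by apply: card_eq_trans (cI _ us1) _; rewrite sz card_eq_sym; apply: cI.
Qed.

End FiniteBases.

Local Open Scope card_scope.

Theorem theorem3p7 (R : realType) (M : lmodType (bicomplex R))
    (hM : finite_dim_free M) (B1 B2 : set M)
    (hB1 : is_basis B1) (hB2 : is_basis B2) :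
  B1 #= B2.
Proof. exact: (card_eq_basis (@bc_proj R)). Qed.
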